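(* Let $n\ge 1$ be an integer, let $\lambda_1,\dots,\lambda_n\in\mathbb{R}$ be rationally independent, let $A_1,\dots,A_n\in\mathbb{C}$ with $A_j\neq 0$ for $j=1,\dots,n$, and let $f:\mathbb{R}\to\mathbb{C}$, $f(t)=\sum_{j=1}^n A_j e^{i\lambda_j t}$. For each $\varepsilon>0$ let $L(\varepsilon)>0$ be an inclusion length of the set $\Omega_\varepsilon(f)$ of $\varepsilon$-almost periods of $f$. Then $$L(\varepsilon)\ge\left(\frac{1}{\varepsilon}\right)^{n-1+o(1)},$$ i.e. for every $\gamma>0$ there exists $\varepsilon_0>0$ such that $$L(\varepsilon)\ge\left(\frac{1}{\varepsilon}\right)^{n-1-\gamma}$$ for all $\varepsilon\in(0,\varepsilon_0)$.
   Context: Real numbers $\lambda_1,\dots,\lambda_n$ are rationally independent if $p_1\lambda_1+\cdots+p_n\lambda_n=0$ with $p_1,\dots,p_n\in\mathbb{Q}$ implies $p_1=\cdots=p_n=0$. A subset $A\subset\mathbb{R}$ is relatively dense in $\mathbb{R}$ if there exists a real number $L>0$ such that $[a,a+L]\cap A\neq\emptyset$ for each $a\in\mathbb{R}$; such a number $L$ is called an inclusion length of $A$. $C_b(\mathbb{R};\mathbb{C})$ is the space of bounded continuous functions $\mathbb{R}\to\mathbb{C}$ with the norm $\|f\|_\infty=\sup_{t\in\mathbb{R}}|f(t)|$. For $f\in C_b(\mathbb{R};\mathbb{C})$ and $s\in\mathbb{R}$, $f_s(t)=f(t+s)$. A real number $\tau$ is an $\varepsilon$-almost period of $f$ if $\|f_\tau-f\|_\infty<\varepsilon$,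 and $\Omega_\varepsilon(f)$ is the set of all $\varepsilon$-almost periods of $f$. The function $f$ is almost periodic if $\Omega_\varepsilon(f)$ is relatively dense for every $\varepsilon>0$. A function of the form $f(t)=\sum_{j=1}^n A_je^{i\lambda_jt}$ is almost periodic, so inclusion lengths $L(\varepsilon)$ exist for every $\varepsilon>0$. *)

(* Defs.v *)
From mathcomp Require Import all_boot all_order all_algebra.
From mathcomp Require Import all_classical all_reals all_analysis.
From mathcomp Require Import complex.

Set Implicit Arguments.
Unset Strict Implicit.
Unset Printing Implicit Defensive.

Import Order.TTheory GRing.Theory Num.Theory.

Local Open Scope classical_set_scope.
Local Open Scope ring_scope.

Definition rationally_independent (R : realType) (n : nat) (lambda : 'I_n -> R)
    : Prop :=
  forall p : 'I_n -> rat,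
    \sum_(j < n) ratr (p j) * lambda j = 0 -> forall j, p j = 0.

Definition inclusion_length (R : realType) (A : set R) (L : R) : Prop :=
  0 < L /\ forall a : R, `[a, a + L] `&` A !=set0.

(* Taken in \bar R so that it is a genuine supremum for every g, and +oo when g
   is unbounded (the real-valued [sup] would then be 0); on bounded functions it
   is the usual real number. *)
Definition sup_norm (R : realType) (g : R -> R[i]) : \bar R :=
  ereal_sup [set (Normc.normc (g t))%:E | t in [set: R]].

Definition almost_periods (R : realType) (f : R -> R[i]) (eps : R) : set R :=
  [set tau | (sup_norm (fun t => (f (t + tau) - f t)%R) < eps%:E)%E].

(* exp(i * theta), through Euler's formula: the library exponential is real. *)
Definition expi (R : realType) (theta : R) : R[i] :=
  Complex (cos theta) (sin theta).

Definition trig_poly (R : realType) (n : nat) (A : 'I_n -> R[i])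
    (lambda : 'I_n -> R) (t : R) : R[i] :=
  \sum_(j < n) A j * expi (lambda j * t).

(* Main.v *)
Require Import Defs.
From mathcomp Require Import all_boot all_order all_algebra.
From mathcomp Require Import all_classical all_reals all_analysis.
From mathcomp Require Import complex.
From mathcomp Require Import ring lra.

(** The argument is a volume count on the torus.

    Bounding the sup norm of a trigonometric polynomial bounds each of its
    coefficients ([coef_le_sup]).  Applied to [f (t + tau) - f t], this shows
    that an eps-almost period [tau] of [f] satisfies
    [|exp(i lambda_j tau) - 1| <= C * eps] for every [j], with [C] depending
    only on the amplitudes ([almost_period_phase_le]).

    By Kronecker's theorem ([kronecker]) the curve
    [t |-> (exp(i lambda_j t))_j] comes arbitrarily close to every point of the
    n-dimensional torus.  If [L] is an inclusion length of the eps-almost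
    periods, any time [t] can be moved into [[0, L]] by subtracting an almost
    period, at the cost of an error [C * eps] in each coordinate.  So the arc of
    the curve over [[0, L]], whose length is of order [L], already meets every
    ball of radius of order [eps].  A family of about [(1/eps)^n] points with
    mutual distances of order [eps] is thus followed by times of [[0, L]], and
    two times less than [eps] apart cannot follow different points: hence
    [(1/eps)^n] is at most of order [L/eps] ([grid_card_le]), that is,
    [L >= c * (1/eps)^(n-1)] ([inclusion_length_ge]).  The exponent [gamma]
    absorbs the constant [c].

    Kronecker's theorem is proved by Bohr's method: if
    [F t = 1 + sum_j u_j^-1 exp(i lambda_j t)], with the [u_j] on the unit
    circle, stayed away from its largest conceivable modulus [n + 1], then its
    powers would be exponentially smaller than [(n + 1)^k].  But [F ^ k] has
    only polynomially many distinct frequencies, and the moduli of its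
    coefficients add up to [(n + 1)^k]; so some coefficient exceeds the supremum
    ([freq_ind_amplitude_sum_le]). *)

Set Implicit Arguments.
Unset Strict Implicit.
Unset Printing Implicit Defensive.

Import Order.TTheory GRing.Theory Num.Theory.
Import numFieldNormedType.Exports.

Local Open Scope classical_set_scope.
Local Open Scope ring_scope.

Local Notation normc := Normc.normc.

(** * The modulus of a complex number and the exponential on the unit circle *)

(** [le_normcD] and [normcN] are stated on the alias [Rcomplex], whose additive
    structure only matches that of [R[i]] up to conversion; this and the next
    lemma restate them where rewriting finds them. *)
Lemma normcD_le (R : realType) (x y : R[i]) :
  normc (x + y) <= normc x + normc y.
Proof. exact: le_normcD. Qed.

Lemma normc_opp (R : realType) (x : R[i]) : normc (- x) = normc x.
Proof. exact: normcN. Qed.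

Lemma normc_sum_le (R : realType) (I : Type) (r : seq I) (P : pred I)
    (F : I -> R[i]) :
  normc (\sum_(i <- r | P i) F i) <= \sum_(i <- r | P i) normc (F i).
Proof.
apply: (big_ind2 (fun x y => normc x <= y)) => [|x a y b xa yb|//].
  by rewrite Normc.normc0.
exact: le_trans (normcD_le x y) (lerD xa yb).
Qed.

Lemma normc_triangle (R : realType) (x y z : R[i]) :
  normc (x - z) <= normc (x - y) + normc (y - z).
Proof. by rewrite -[x - z](subrKA y) normcD_le. Qed.

Lemma normc_ge0 (R : realType) (x : R[i]) : 0 <= normc x.
Proof. by case: x => a b; exact: sqrtr_ge0. Qed.

Lemma normcX (R : realType) (x : R[i]) k : normc (x ^+ k) = normc x ^+ k.
Proof.
elim: k => [|k IH]; first by rewrite !expr0 Normc.normc1.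
by rewrite !exprS Normc.normcM IH.
Qed.

Lemma normc_prod (R : realType) (I : Type) (r : seq I) (P : pred I)
    (F : I -> R[i]) :
  normc (\prod_(i <- r | P i) F i) = \prod_(i <- r | P i) normc (F i).
Proof.
by apply: big_morph; [exact: Normc.normcM | exact: Normc.normc1].
Qed.

Lemma normc_nat (R : realType) (m : nat) : normc (m%:R : R[i]) = m%:R.
Proof. by rewrite (normcMn (1 : R[i])) Normc.normc1. Qed.

Lemma normc_ge_Re_dist (R : realType) (x y : R[i]) :
  `|complex.Re x - complex.Re y| <= normc (x - y).
Proof.
case: x y => [a b] [c d] /=; rewrite -sqrtr_sqr ler_sqrt ?lerDl ?sqr_ge0 //.
by rewrite addr_ge0 ?sqr_ge0.
Qed.

Lemma expi0 (R : realType) : expi (0 : R) = 1.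
Proof. by rewrite /expi cos0 sin0. Qed.

Lemma expiD (R : realType) (x y : R) : expi (x + y) = expi x * expi y.
Proof. by rewrite /expi cosD sinD; congr Complex; rewrite addrC. Qed.

Lemma expiMn (R : realType) (x : R) k : expi (x *+ k) = expi x ^+ k.
Proof.
elim: k => [|k IH]; first by rewrite mulr0n expr0 expi0.
by rewrite mulrS expiD IH exprS.
Qed.

Lemma expi_sum (R : realType) (I : Type) (r : seq I) (P : pred I) (F : I -> R) :
  expi (\sum_(i <- r | P i) F i) = \prod_(i <- r | P i) expi (F i).
Proof. by apply: (big_morph _ (@expiD R)); exact: expi0. Qed.

Lemma normc_expi (R : realType) (x : R) : normc (expi x) = 1.
Proof. by rewrite /= cos2Dsin2 sqrtr1. Qed.

Lemma normc_expiB (R : realType) (x y : R) :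
  normc (expi x - expi y) = normc (expi (x - y) - 1).
Proof.
have -> : expi x - expi y = expi y * (expi (x - y) - 1).
  by rewrite mulrBr mulr1 -expiD [y + _]addrC subrK.
by rewrite Normc.normcM normc_expi mul1r.
Qed.

Lemma norm_sin_le (R : realType) (x : R) : `|sin x| <= `|x|.
Proof.
wlog x0 : x / 0 <= x => [H|].
  have [/H//|/ltW] := leP 0 x; rewrite -oppr_ge0 => /H.
  by rewrite sinN !normrN.
have [c _] : exists2 c, c \in `[0, x]%R & sin x - sin 0 = cos c * (x - 0).
  apply: (@MVT_segment _ sin cos) => //.
  by apply: continuous_subspaceT => y; exact: continuous_sin.
rewrite sin0 !subr0 => ->; rewrite normrM ler_piMl //; exact: cos_max.
Qed.

(** The chord [|exp(ix) - 1|] is [2 |sin (x/2)|]. *)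
Lemma normc_expiB1_le (R : realType) (x : R) : normc (expi x - 1) <= `|x|.
Proof.
rewrite -(@ler_pXn2r _ 2) ?nnegrE ?normc_ge0 //.
rewrite real_normK ?num_real //= sqr_sqrtr ?addr_ge0 ?sqr_ge0 // subr0.
have := norm_sin_le (x / 2).
rewrite -[_ <= `|x / 2|](@ler_pXn2r _ 2) ?nnegrE // !real_normK ?num_real //.
rewrite sin2cos2.
have := cos2Dsin2 x.
have -> : cos x = cos (x / 2) ^+ 2 *+ 2 - 1.
  by rewrite -cos_mulr2n; congr cos; lra.
set c := cos (x / 2); set s := sin x => h1 h2; nra.
Qed.

Lemma expi_neq1 (R : realType) (x : R) : x != 0 -> `|x| < 1 -> expi x != 1.
Proof.
move=> x0 x1; apply/eqP => -[_] /eqP.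
apply/negP; rewrite -normr_gt0.
have s0 : 0 < sin `|x|.
  by apply: sin2_gt0; rewrite normr_gt0 x0 (lt_trans x1) // ltr1n.
rewrite normr_gt0; case: (ger0P x) s0 => _.
  by move=> s0; rewrite gt_eqF.
by rewrite sinN oppr_gt0 => s0; rewrite lt_eqF.
Qed.

(** * Coefficients of a trigonometric polynomial are bounded by its supremum *)

Lemma le_of_natmul_le (R : realType) (s M B : R) :
  (forall N : nat, N%:R * s <= N%:R * M + B) -> s <= M.
Proof.
move=> h; rewrite leNgt; apply/negP => lt; have d0 : 0 < s - M by lra.
have := truncnS_gt (B / (s - M)); set N := (Num.truncn _).+1 => hN.
have := h N; rewrite ltr_pdivrMr // in hN; nra.
Qed.

Lemma geom_sum_bound (R : realType) (z : R[i]) (N : nat) :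
  normc z = 1 -> z != 1 ->
  normc (\sum_(k < N) z ^+ k) <= 2 / normc (z - 1).
Proof.
move=> z1 zn1; have z0 : 0 < normc (z - 1).
  rewrite lt_neqAle normc_ge0 andbT eq_sym; apply: contra zn1 => /eqP.
  by move/Normc.eq0_normc/eqP; rewrite subr_eq0.
rewrite ler_pdivlMr // mulrC -Normc.normcM -subrX1.
apply: le_trans (normcD_le _ _) _.
by rewrite normc_opp normcX z1 expr1n Normc.normc1.
Qed.

(** Averaging [P t * exp(-ixt)] over [t] isolates the terms of frequency [x].
    Sampling at the multiples of a step [h] makes the average a finite sum: the
    other terms become geometric sums, bounded independently of the number of
    samples provided that [h] is so small that no ratio equals 1.  Frequencies
    may repeat, hence the sum of coefficients in the conclusion. *)
Lemma coef_le_sup (R : realType) (I : finType) (c : I -> R[i]) (mu : I -> R)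
    (M : R) :
  (forall t, normc (\sum_i c i * expi (mu i * t)) <= M) ->
  forall x, normc (\sum_(i | mu i == x) c i) <= M.
Proof.
move=> hM x.
(* All [|(mu i - x) * h|] are below 1, so that no nonzero one is a
   multiple of [2 pi]. *)
pose h := (1 + \sum_i `|mu i - x|)^-1.
have S0 : 0 <= \sum_i `|mu i - x| by apply: sumr_ge0.
have h0 : 0 < h by rewrite invr_gt0; lra.
pose z i := expi ((mu i - x) * h).
have z1 i : mu i != x -> z i != 1.
  move=> ix; apply: expi_neq1; first by rewrite mulf_neq0 ?subr_eq0 // gt_eqF.
  rewrite normrM (gtr0_norm h0) ltr_pdivrMr ?mul1r; last by lra.
  rewrite (bigD1 i) //=.
  have : 0 <= \sum_(j | j != i) `|mu j - x| by apply: sumr_ge0.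
  by lra.
pose B := \sum_(i | mu i != x) normc (c i) * (2 / normc (z i - 1)).
apply: (@le_of_natmul_le _ _ _ B) => N.
have split_sum : N%:R * (\sum_(i | mu i == x) c i) =
    \sum_(k < N) expi (- (x * (h *+ k))) * (\sum_i c i * expi (mu i * (h *+ k)))
    - \sum_(i | mu i != x) c i * \sum_(k < N) z i ^+ k.
  apply/eqP; rewrite eq_sym subr_eq; apply/eqP.
  transitivity (\sum_i c i * \sum_(k < N) z i ^+ k).
    under eq_bigr => k _ do rewrite mulr_sumr.
    rewrite exchange_big /=; apply: eq_bigr => i _; rewrite mulr_sumr.
    apply: eq_bigr => k _; rewrite mulrCA -expiD -expiMn; congr (_ * expi _).
    by rewrite -mulrnAr; ring.
  rewrite (bigID (fun i => mu i == x)) /= mulr_sumr; congr (_ + _).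
  apply: eq_bigr => i /eqP ix; rewrite mulrC; congr (_ * _).
  rewrite /z ix subrr mul0r expi0.
  by under eq_bigr do rewrite expr1n; rewrite sumr_const card_ord.
rewrite -normc_nat -Normc.normcM split_sum normc_nat.
apply: le_trans (normcD_le _ _) _; rewrite normc_opp; apply: lerD.
  apply: le_trans (normc_sum_le _ _ _) _.
  rewrite mulr_natl -[X in _ *+ X]card_ord -sumr_const; apply: ler_sum => k _.
  by rewrite Normc.normcM normc_expi mul1r.
apply: le_trans (normc_sum_le _ _ _) _; apply: ler_sum => i ix.
rewrite Normc.normcM ler_wpM2l ?normc_ge0 //.
by apply: geom_sum_bound; [exact: normc_expi | exact: z1].
Qed.

(** * Kronecker's theorem *)

(** Exponential growth beats polynomial growth.  With [q / M = 1 + x],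
    Bernoulli's inequality raised to the power [d + 1] gives a polynomial lower
    bound of degree [d + 1], against an upper bound of degree [d]. *)
Lemma exp_le_polyexp (R : realType) (q M : R) (d : nat) :
  0 <= M -> (forall k : nat, q ^+ k <= k.+1%:R ^+ d * M ^+ k) -> q <= M.
Proof.
move=> M0 h; rewrite leNgt; apply/negP => Mq.
have Mpos : 0 < M.
  rewrite lt_neqAle M0 andbT; apply/eqP => M00; have := h 1%N.
  by rewrite -M00 !expr1 mulr0 leNgt M00 Mq.
pose x := q / M - 1.
have x0 : 0 < x by rewrite subr_gt0 ltr_pdivlMr // mul1r.
have hx k : (1 + x) ^+ k <= k.+1%:R ^+ d.
  by rewrite addrCA subrr addr0 expr_div_n ler_pdivrMr ?exprn_gt0.
have bern k : 1 + k%:R * x <= (1 + x) ^+ k.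
  elim: k => [|k IH]; first by rewrite mul0r addr0.
  rewrite exprS; apply: (le_trans _ (ler_wpM2l _ IH)); last by lra.
  rewrite -natr1; have : 0 <= k%:R * x ^+ 2 by rewrite mulr_ge0 ?sqr_ge0.
  nra.
(* Take the exponent [m.+1 * d.+1], and split it as a power of a power. *)
have key m : m.+1%:R * x ^+ d.+1 <= d.+2%:R ^+ d.
  have mp : 0 < m.+1%:R ^+ d :> R by rewrite exprn_gt0.
  rewrite -(ler_pM2r mp) -exprMn mulrAC -exprS -exprMn.
  apply: le_trans (_ : (1 + x) ^+ (m.+1 * d.+1) <= _).
    rewrite exprM; apply: lerXn2r.
    - by rewrite nnegrE mulr_ge0 ?(ltW x0).
    - by rewrite nnegrE exprn_ge0 //; lra.
    - by apply: le_trans (bern _); lra.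
  apply: le_trans (hx _) _; rewrite -natrM.
  apply: lerXn2r; rewrite ?nnegrE // ler_nat.
  by rewrite mulnC -addn1 (mulSn d.+1) addnC leq_add2r.
have xd : 0 < x ^+ d.+1 by rewrite exprn_gt0.
have := truncnS_gt (d.+2%:R ^+ d / x ^+ d.+1).
by rewrite ltr_pdivrMr // ltNge key.
Qed.

(** The [k]-th power expands over the maps [g : 'I_k -> J]; the term of [g] has
    frequency [\sum_i nu (g i)] and a coefficient of modulus 1.  Independence
    of the frequencies says that two maps share a frequency only if they take
    each value equally often, and then their coefficients are equal and add up
    without cancellation.  So each class of maps has at most [M ^+ k] elements,
    and there are at most [k.+1 ^ #|J|] classes.  Independence is only asked of
    families of multiplicities with the same total, which lets the constant
    frequency 0 be one of the [nu j]. *)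
Lemma freq_ind_amplitude_sum_le (R : realType) (J : finType) (w : J -> R[i])
    (nu : J -> R) (M : R) :
  (forall j, normc (w j) = 1) ->
  (forall m m' : J -> nat, (\sum_j m j = \sum_j m' j)%N ->
     \sum_j nu j *+ m j = \sum_j nu j *+ m' j -> m =1 m') ->
  (forall t, normc (\sum_j w j * expi (nu j * t)) <= M) ->
  #|J|%:R <= M.
Proof.
move=> w1 nu_ind hM.
have M0 : 0 <= M := le_trans (normc_ge0 _) (hM 0).
apply: (@exp_le_polyexp _ _ _ #|J|) => // k.
pose cnt (g : {ffun 'I_k -> J}) j := #|[pred i | g i == j]|.
have prod_cnt (g : {ffun 'I_k -> J}) : \prod_i w (g i) = \prod_j w j ^+ cnt g j.
  rewrite (partition_big g predT) //=; apply: eq_bigr => j _.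
  by rewrite -prodr_const; apply: eq_bigr => i /eqP ->.
have sum_cnt (g : {ffun 'I_k -> J}) : \sum_i nu (g i) = \sum_j nu j *+ cnt g j.
  rewrite (partition_big g predT) //=; apply: eq_bigr => j _.
  by rewrite -sumr_const; apply: eq_bigr => i /eqP ->.
have card_cnt (g : {ffun 'I_k -> J}) : (\sum_j cnt g j = k)%N.
  rewrite -[RHS]card_ord -sum1_card (partition_big g predT) //=.
  by apply: eq_bigr => j _; rewrite sum1_card.
have power_expansion t : (\sum_j w j * expi (nu j * t)) ^+ k =
    \sum_(g : {ffun 'I_k -> J})
      (\prod_i w (g i)) * expi ((\sum_i nu (g i)) * t).
  rewrite -[X in _ ^+ X]card_ord -prodr_const bigA_distr_bigA /=.
  by apply: eq_bigr => g _; rewrite big_split mulr_suml expi_sum.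
have class_le g0 : #|[pred g | [forall j, cnt g j == cnt g0 j]]|%:R <= M ^+ k.
  have bnd t : normc (\sum_(g : {ffun 'I_k -> J})
      (\prod_i w (g i)) * expi ((\sum_i nu (g i)) * t)) <= M ^+ k.
    by rewrite -power_expansion normcX lerXn2r ?nnegrE ?normc_ge0.
  apply: le_trans (coef_le_sup bnd (\sum_i nu (g0 i))).
  rewrite (eq_bigl [pred g | [forall j, cnt g j == cnt g0 j]]); last first.
    move=> g; apply/eqP/forallP => [|gg0]; last first.
      by rewrite !sum_cnt; apply: eq_bigr => j _; rewrite (eqP (gg0 j)).
    rewrite !sum_cnt => eqs j; apply/eqP.
    by apply: (nu_ind (cnt g)) => //; rewrite !card_cnt.
  rewrite (eq_bigr (fun=> \prod_i w (g0 i))); last first.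
    move=> g /forallP gg0; rewrite !prod_cnt; apply: eq_bigr => j _.
    by rewrite (eqP (gg0 j)).
  rewrite sumr_const -[_ *+ _ in leRHS]mulr_natl Normc.normcM normc_nat.
  rewrite normc_prod.
  by rewrite big1 ?mulr1 // => i _; exact: w1.
pose tally (g : {ffun 'I_k -> J}) : {ffun J -> 'I_k.+1} :=
  [ffun j => inord (cnt g j)].
have tallyE g j : tally g j = cnt g j :> nat.
  rewrite ffunE inordK // ltnS -(card_cnt g) (bigD1 j) //=; exact: leq_addr.
have -> : #|J|%:R ^+ k = \sum_(m : {ffun J -> 'I_k.+1})
    #|[pred g | tally g == m]|%:R :> R.
  rewrite -natr_sum -natrX -[X in (_ ^ X)%N]card_ord -card_ffun -sum1_card.
  rewrite (partition_big tally predT) //=; congr (_%:R).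
  by apply: eq_bigr => m _; rewrite sum1_card.
apply: le_trans (_ : \sum_(m : {ffun J -> 'I_k.+1}) M ^+ k <= _); last first.
  by rewrite sumr_const card_ffun card_ord -[M ^+ k *+ _]mulr_natl natrX.
apply: ler_sum => m _.
have [g0 /eqP hg0|none] := pickP [pred g | tally g == m]; last first.
  by rewrite (eq_card0 none) exprn_ge0.
apply: le_trans (class_le g0); rewrite ler_nat; apply: subset_leq_card.
apply/fintype.subsetP => g; rewrite !inE => /eqP gm; apply/forallP => j.
by rewrite -!tallyE gm hg0.
Qed.

(** The parallelogram identity [|1 + z|^2 + |1 - z|^2 = 4] on the unit circle,
    in a form linear in [|1 + z|]. *)
Lemma normc_1D_le (R : realType) (z : R[i]) (d : R) :
  normc z = 1 -> 0 <= d -> d <= normc (z - 1) ->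
  normc (1 + z) <= 2 - d ^+ 2 / 4.
Proof.
case: z => a b z1 d0 hd.
have e1 : a ^+ 2 + b ^+ 2 = 1.
  by rewrite -[RHS](expr1n _ 2) -z1 /= sqr_sqrtr ?addr_ge0 ?sqr_ge0.
have e2 : normc ((Complex a b) - 1) ^+ 2 = (a - 1) ^+ 2 + b ^+ 2.
  by rewrite /= sqr_sqrtr ?addr_ge0 ?sqr_ge0 // subr0.
have e3 : normc (1 + (Complex a b)) ^+ 2 = (1 + a) ^+ 2 + b ^+ 2.
  by rewrite /= sqr_sqrtr ?addr_ge0 ?sqr_ge0 // add0r.
have hd2 : d ^+ 2 <= (a - 1) ^+ 2 + b ^+ 2.
  by rewrite -e2 lerXn2r ?nnegrE ?normc_ge0.
have d4 : d ^+ 2 <= 4 by nra.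
rewrite -(@ler_pXn2r _ 2) ?nnegrE ?normc_ge0 //; last by lra.
rewrite e3; have := sqr_ge0 (d ^+ 2); nra.
Qed.

Lemma rationally_independent_nat (R : realType) (n : nat) (lambda : 'I_n -> R)
    (m m' : 'I_n -> nat) : rationally_independent lambda ->
  \sum_j lambda j *+ m j = \sum_j lambda j *+ m' j -> m =1 m'.
Proof.
move=> ind e j.
have := ind (fun j => (m j)%:R - (m' j)%:R) _ j.
move=> H; apply/eqP; rewrite -(eqr_nat rat) -subr_eq0; apply/eqP/H.
under eq_bigr => i _ do rewrite rmorphB /= !ratr_nat mulrBl !mulr_natl.
by rewrite sumrB e subrr.
Qed.

(** If [|exp(i lambda_j t) - u_j| >= d] for some [j] at every time [t], then two
    of the [n + 1] unit terms of [1 + sum_j u_j^-1 exp(i lambda_j t)] are not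
    aligned, and the modulus of the sum stays below [n + 1 - d^2/4]. *)
Lemma kronecker (R : realType) (n : nat) (lambda : 'I_n -> R)
    (u : 'I_n -> R[i]) (d : R) :
  rationally_independent lambda -> (forall j, normc (u j) = 1) -> 0 < d ->
  exists t, forall j, normc (expi (lambda j * t) - u j) < d.
Proof.
move=> ind u1 d0; apply: contrapT => no_t.
have far t : exists j, d <= normc (expi (lambda j * t) - u j).
  apply: contrapT => near; apply: no_t; exists t => j; rewrite ltNge.
  by apply/negP => dj; apply: near; exists j.
(* Index 0 carries the constant term 1, that is, the frequency 0. *)
pose w (i : 'I_n.+1) : R[i] := if unlift ord0 i is Some j then (u j)^-1 else 1.
pose nu (i : 'I_n.+1) := if unlift ord0 i is Some j then lambda j else 0.
suff : #|'I_n.+1|%:R <= n.+1%:R - d ^+ 2 / 4.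
  have d2 : 0 < d ^+ 2 by rewrite exprn_gt0.
  by rewrite card_ord => h; lra.
apply: (@freq_ind_amplitude_sum_le _ _ w nu).
- move=> i; rewrite /w; case: unliftP => [j _|_]; last exact: Normc.normc1.
  by rewrite Normc.normcV u1 invr1.
- move=> m m'; rewrite !big_ord_recl /nu unlift_none !mul0rn !add0r => em.
  under eq_bigr do rewrite liftK.
  under [RHS]eq_bigr do rewrite liftK.
  move=> /(@rationally_independent_nat _ _ _ _ _ ind) e.
  have e0 : m ord0 = m' ord0.
    apply/eqP; rewrite -(eqn_add2r (\sum_(i < n) m (lift ord0 i))); apply/eqP.
    by rewrite em; congr addn; apply: eq_bigr => i _; rewrite e.
  by move=> i; case: (unliftP ord0 i) => [j ->|-> //]; exact: e.
move=> t; have [j0 hj0] := far t.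
have z1 j : normc ((u j)^-1 * expi (lambda j * t)) = 1.
  by rewrite Normc.normcM Normc.normcV u1 normc_expi invr1 mulr1.
have u0 : u j0 != 0.
  apply/eqP => u0; have := u1 j0; rewrite u0 Normc.normc0 => /eqP.
  by rewrite eq_sym oner_eq0.
rewrite big_ord_recl /w /nu unlift_none mul1r mul0r expi0.
under eq_bigr do rewrite liftK.
rewrite (bigD1 j0) //= addrA; apply: le_trans (normcD_le _ _) _.
have far0 : d <= normc ((u j0)^-1 * expi (lambda j0 * t) - 1).
  rewrite -(mulVf u0) -mulrBr Normc.normcM Normc.normcV u1 invr1 mul1r //.
have h1 := normc_1D_le (z1 j0) (ltW d0) far0.
have h2 : normc (\sum_(j < n | j != j0) (u j)^-1 * expi (lambda j * t)) <=
    n%:R - 1.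
  apply: le_trans (normc_sum_le _ _ _) _.
  under eq_bigr do rewrite z1.
  rewrite -[X in X%:R - 1]card_ord -sumr_const [X in X - 1](bigD1 j0) //=.
  by rewrite addrAC subrr add0r.
by rewrite -natr1; lra.
Qed.

(** * Counting separated points of the torus *)

Lemma rationally_independent_inj (R : realType) (n : nat)
    (lambda : 'I_n -> R) : rationally_independent lambda -> injective lambda.
Proof.
move=> ind i j e.
have pick k : \sum_l lambda l *+ (l == k) = lambda k.
  rewrite (bigD1 k) //= eqxx big1 ?addr0 // => l /negbTE ->.
  by rewrite mulr0n.
have /(_ i) : (fun l => (l == i) : nat) =1 (fun l => (l == j) : nat).
  by apply: (rationally_independent_nat ind); rewrite !pick.
by rewrite eqxx; case: eqP.
Qed.

Lemma almost_period_phase_le (R : realType) (n : nat) (lambda : 'I_n -> R)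
    (A : 'I_n -> R[i]) (eps tau : R) : injective lambda ->
  almost_periods (trig_poly A lambda) eps tau ->
  forall j, normc (A j) * normc (expi (lambda j * tau) - 1) <= eps.
Proof.
move=> lambda_inj tauP j.
pose c j := A j * (expi (lambda j * tau) - 1).
have diffE t : trig_poly A lambda (t + tau) - trig_poly A lambda t =
    \sum_j c j * expi (lambda j * t).
  rewrite /trig_poly -sumrB; apply: eq_bigr => i _.
  by rewrite /c mulrDr expiD; ring.
have bnd t : normc (\sum_j c j * expi (lambda j * t)) <= eps.
  rewrite -diffE -lee_fin; apply: le_trans (ltW tauP).
  by apply: ereal_sup_ubound; exists t.
have := coef_le_sup bnd (lambda j).
by rewrite (big_pred1 j) ?Normc.normcM // => i; rewrite /= (inj_eq lambda_inj).
Qed.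

(** The [K ^ n] test points have coordinates [u k] on the unit circle with real
    parts [k / K], so that distinct points are [1 / K] apart in some coordinate.
    Each is followed, within [(1 + C) * eps], by the curve at a time
    [s b] in [[0, L]].  Cutting [[0, L]] into cells of length [eps], over which
    a coordinate moves by at most [|lambda j| * eps], the condition on [K]
    prevents two test points from having their times in the same cell. *)
Lemma grid_card_le (R : realType) (n : nat) (lambda : 'I_n -> R) (T : set R)
    (eps C L : R) (K : nat) :
  rationally_independent lambda -> 0 < eps -> inclusion_length T L ->
  (forall tau, T tau ->
     forall j, normc (expi (lambda j * tau) - 1) <= C * eps) ->
  K%:R * ((2 + 2 * C + \sum_j `|lambda j|) * eps) <= 1 ->
  K%:R ^+ n <= L / eps + 1.
Proof.
move=> ind e0 [L0 hL] hT hK.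
pose u (k : 'I_K) : R[i] :=
  Complex (k%:R / K%:R) (Num.sqrt (1 - (k%:R / K%:R) ^+ 2)).
have u1 k : normc (u k) = 1.
  have K0 : 0 < K%:R :> R by rewrite ltr0n (leq_trans _ (ltn_ord k)).
  have k1 : k%:R / K%:R <= 1 :> R.
    by rewrite ler_pdivrMr // mul1r ler_nat ltnW.
  rewrite /= sqr_sqrtr ?subr_ge0 ?expr_le1 ?divr_ge0 //.
  by rewrite addrC subrK sqrtr1.
have visit (b : {ffun 'I_n -> 'I_K}) : exists s, 0 <= s <= L /\
    forall j, normc (expi (lambda j * s) - u (b j)) < (1 + C) * eps.
  have [t ht] := @kronecker _ _ lambda (fun j => u (b j)) _ ind
    (fun j => u1 (b j)) e0.
  have [tau [tauI tauT]] := hL (t - L).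
  (* [tau] is an almost period in [[t - L, t]], so [t - tau] lies in
     [[0, L]]. *)
  exists (t - tau); split.
    move: tauI; rewrite /= in_itv /= subrK subr_ge0 lerBlDl lerBlDr addrC.
    by move=> /andP[-> ->].
  move=> j; apply: le_lt_trans (normc_triangle _ (expi (lambda j * t)) _) _.
  rewrite -(normc_opp (expi _ - expi _)) opprB normc_expiB -mulrBr subKr.
  rewrite addrC mulrDl mul1r.
  exact: ltr_leD (ht j) (hT _ tauT j).
have [s hs] := choice visit.
have cell_lt b : (Num.truncn (s b / eps) < (Num.truncn (L / eps)).+1)%N.
  have [/andP[s0 sL] _] := hs b.
  by rewrite ltnS le_truncn // ler_pM2r ?invr_gt0.
pose cell b := Ordinal (cell_lt b).
have cell_inj : injective cell.
  move=> b b' /(congr1 val) /= ebb'.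
  have [/andP[s0 _] hb] := hs b; have [/andP[s0' _] hb'] := hs b'.
  have close : `|s b - s b'| <= eps.
    have /andP[h1 h2] := truncn_itv (divr_ge0 s0 (ltW e0)).
    have /andP[h3 h4] := truncn_itv (divr_ge0 s0' (ltW e0)).
    rewrite -ebb' in h3 h4.
    rewrite ler_pdivlMr // in h1; rewrite ltr_pdivrMr // in h2.
    rewrite ler_pdivlMr // in h3; rewrite ltr_pdivrMr // in h4.
    by rewrite -natr1 in h2 h4; rewrite ler_norml; apply/andP; split; lra.
  apply/ffunP => j; apply: contrapT => bj.
  have K0 : 0 < K%:R :> R by rewrite ltr0n (leq_trans _ (ltn_ord (b j))).
  have d1 : 1 / K%:R <= normc (u (b j) - u (b' j)).
    apply: le_trans (normc_ge_Re_dist _ _).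
    rewrite /= -mulrBl normrM (gtr0_norm (_ : 0 < K%:R^-1)) ?invr_gt0 //.
    rewrite ler_pM2r ?invr_gt0 //.
    have : (b j : nat) != b' j by apply/eqP => e; apply: bj; apply: val_inj.
    rewrite neq_ltn => /orP[]; rewrite -(ler_nat R) -natr1 => h.
      by rewrite distrC ger0_norm; lra.
    by rewrite ger0_norm; lra.
  have d2 : normc (expi (lambda j * s b) - expi (lambda j * s b')) <=
      (\sum_j `|lambda j|) * eps.
    rewrite normc_expiB -mulrBr.
    apply: le_trans (normc_expiB1_le _) _; rewrite normrM.
    apply: ler_pM => //; rewrite (bigD1 j) //= lerDl; exact: sumr_ge0.
  have d3 := normc_triangle (u (b j)) (expi (lambda j * s b)) (u (b' j)).
  have d4 := normc_triangle (expi (lambda j * s b)) (expi (lambda j * s b'))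
    (u (b' j)).
  have d5 := hb j; have d6 := hb' j.
  rewrite -normc_opp opprB in d5.
  have : 1 / K%:R < (2 + 2 * C + \sum_j `|lambda j|) * eps by lra.
  by rewrite ltr_pdivrMr // mulrC; lra.
have := leq_card _ cell_inj; rewrite card_ffun !card_ord -(ler_nat R) natrX.
move=> /le_trans; apply; rewrite -natr1 lerD2r truncn_le.
by rewrite divr_ge0 // ltW.
Qed.

(** The largest admissible grid has [K] of order [1 / (D * eps)]; for
    [eps < 1 / (4 * D)] rounding loses at most a factor 2 in [K], and
    [K ^ n >= 2] lets the additive 1 of [grid_card_le] be absorbed. *)
Lemma inclusion_length_ge (R : realType) (n : nat) (lambda : 'I_n -> R)
    (A : 'I_n -> R[i]) : (1 <= n)%N ->
  rationally_independent lambda -> (forall j, A j <> 0) ->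
  exists c eps1 : R, [/\ 0 < c, 0 < eps1 & forall eps L : R,
    0 < eps -> eps < eps1 ->
    inclusion_length (almost_periods (trig_poly A lambda) eps) L ->
    c * eps^-1 ^+ n.-1 <= L].
Proof.
move=> n1 ind A0.
have nA j : 0 < normc (A j).
  rewrite lt_neqAle normc_ge0 andbT; apply/eqP => /esym.
  by move/Normc.eq0_normc; exact: A0.
pose C := \sum_j (normc (A j))^-1.
have C0 : 0 <= C by apply: sumr_ge0 => j _; rewrite invr_ge0 ltW.
pose D := 2 + 2 * C + \sum_j `|lambda j|.
have D0 : 0 < D.
  have : 0 <= \sum_j `|lambda j| by apply: sumr_ge0.
  by rewrite /D; lra.
exists (2 * (2 * D) ^+ n)^-1, (4 * D)^-1; split.
- by rewrite invr_gt0 mulr_gt0 // exprn_gt0 // mulr_gt0.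
- by rewrite invr_gt0 mulr_gt0.
move=> eps L e0 e1 hL.
pose x := (D * eps)^-1.
have De0 : 0 < D * eps by rewrite mulr_gt0.
have x4 : 4 <= x.
  rewrite -[4]invrK lef_pV2 ?posrE ?invr_gt0 //.
  move: e1; rewrite -[_^-1]mul1r ltr_pdivlMr ?mulr_gt0 // => e1.
  by rewrite -[4^-1]mul1r ler_pdivlMr //; lra.
have /andP[Kx xK] := truncn_itv (le_trans (ler0n _ 4) x4).
set K := Num.truncn x in Kx xK; rewrite -natr1 in xK.
have phase tau : almost_periods (trig_poly A lambda) eps tau ->
    forall j, normc (expi (lambda j * tau) - 1) <= C * eps.
  move=> /(almost_period_phase_le (rationally_independent_inj ind)) h j.
  apply: le_trans (_ : (normc (A j))^-1 * eps <= _).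
    by rewrite ler_pdivlMl.
  rewrite ler_pM2r // /C (bigD1 j) //= lerDl.
  by apply: sumr_ge0 => i _; rewrite invr_ge0 ltW.
have KD : K%:R * (D * eps) <= 1.
  by rewrite -ler_pdivlMr // mul1r.
have count := grid_card_le ind e0 hL phase KD.
have Kn2 : 2 <= K%:R ^+ n :> R.
  apply: le_trans (_ : K%:R <= _); first by lra.
  by rewrite -[leLHS]expr1 ler_weXn2l //; lra.
have Knx : (x / 2) ^+ n <= K%:R ^+ n.
  by rewrite lerXn2r ?nnegrE //; lra.
have Le : (x / 2) ^+ n / 2 <= L / eps by lra.
rewrite ler_pdivlMr // in Le; apply: le_trans Le.
rewrite le_eqVlt; apply/orP; left; apply/eqP.
have -> : x / 2 = eps^-1 * (2 * D)^-1 by rewrite /x; field; rewrite !gt_eqF.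
have -> : eps^-1 ^+ n.-1 = eps^-1 ^+ n * eps.
  by rewrite -[in RHS](prednK n1) exprSr mulfVK ?gt_eqF.
by rewrite [in RHS]exprMn invfM -exprVn; ring.
Qed.

Theorem theorem3 (R : realType) (n : nat) (hn : (1 <= n)%N)
    (lambda : 'I_n -> R) (hlambda : rationally_independent lambda)
    (A : 'I_n -> R[i]) (hA : forall j : 'I_n, A j <> 0)
    (L : R -> R)
    (hL : forall eps : R, 0 < eps ->
      inclusion_length (almost_periods (trig_poly A lambda) eps) (L eps)) :
  forall gamma : R, 0 < gamma ->
    exists eps0 : R, 0 < eps0 /\
      forall eps : R, 0 < eps -> eps < eps0 ->
        (1 / eps) `^ (n%:R - 1 - gamma) <= L eps.
Proof.
move=> gamma g0.
have [c [eps1 [c0 e10 key]]] := inclusion_length_ge hn hlambda hA.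
(* Below [eps2], the factor [eps^-1 `^ gamma] exceeds [c^-1]. *)
pose eps2 := (c^-1 `^ gamma^-1)^-1.
have ci0 : 0 < c^-1 by rewrite invr_gt0.
have e20 : 0 < eps2 by rewrite invr_gt0 powR_gt0.
exists (Num.min eps1 eps2); split; first by rewrite lt_min e10.
move=> eps e0; rewrite lt_min => /andP[ee1 ee2].
apply: le_trans (key _ _ e0 ee1 (hL _ e0)).
have ie0 : 0 < eps^-1 by rewrite invr_gt0.
rewrite div1r powRB; last by rewrite (gt_eqF ie0) implybT.
have -> : n%:R - 1 = n.-1%:R :> R by rewrite -[in LHS](prednK hn) -natr1 addrK.
rewrite powR_mulrn ?(ltW ie0) // mulrC ler_pM2r ?exprn_gt0 //.
rewrite -[c]invrK lef_pV2 ?posrE ?powR_gt0 //.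
have -> : c^-1 = (c^-1 `^ gamma^-1) `^ gamma.
  by rewrite -powRrM mulVf ?gt_eqF // powRr1 // ltW.
apply: ge0_ler_powR; rewrite ?nnegrE ?powR_ge0 ?ltW //.
by rewrite -[ltLHS]invrK ltf_pV2 ?posrE.
Qed.
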